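(* Let $X$ be a set and $\mathcal F,\mathcal G\subset\mathbb R^X$, with $\mathcal F$ pointwise upper bounded. The inequality $$\sum_{i=1}^n[g_i,\delta_i]\le\sup_{f\in\mathcal F}\Big[f,\sum_{i=1}^n\delta_i\Big]$$ holds for every finite subset $\{(g_1,\delta_1),\dots,(g_n,\delta_n)\}$ of $\mathcal G\times\Delta(X)$ if and only if there is $m\in\mathbb P(\mathcal F;\mathcal E(X))$ such that $$g(x)\le\int_{\mathcal F}f(x)\,m(df)\qquad\text{for all } g\in\mathcal G,\ x\in X.$$
   Context: All underlying sets on which functions or probabilities are considered are non-empty. $\mathbb R^X$ is the set of all real-valued functions on $X$. $\mathcal F$ is pointwise upper bounded if $\sup_{f\in\mathcal F}f(x)<+\infty$ for every $x\in X$. $\Delta(X)$ is the set of functions $\delta:X\to\mathbb R_+$ with finite support such that $\sum_{x\in X}\delta(x)=1$. For $f\in\mathbb R^X$ and $h:X\to\mathbb R$ with finite support, $[f,h]=\sum_{x\in X}f(x)h(x)$. $\mathbb P(\mathcal F;\mathcal E(X))$ is the set of finitely additive probabilities $m$ on the power set of $\mathcal F$ such that, for every $x\in X$, the evaluation $f\mapsto f(x)$ is $m$-integrable on $\mathcal F$ (Dunford–Schwartz integral). *)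

(* Defs.v *)
From HB Require Import structures.
From mathcomp Require Import all_boot all_order all_algebra.
From mathcomp Require Import all_classical all_reals all_analysis.

Set Implicit Arguments.
Unset Strict Implicit.
Unset Printing Implicit Defensive.

Import Order.TTheory GRing.Theory Num.Theory.
Import numFieldNormedType.Exports.

Local Open Scope classical_set_scope.
Local Open Scope ring_scope.

Definition pointwise_upper_bounded (R : realType) (X : Type)
    (F : set (X -> R)) : Prop :=
  forall x, (ereal_sup [set (f x)%:E | f in F] < +oo)%E.

(* The finite support is required explicitly: a finitely supported sum over
   [set: X] is by convention 0 when infinitely many terms are nonzero. *)
Definition Delta (R : realType) (X : choiceType) : set (X -> R) :=
  [set d | [/\ forall x, 0 <= d x,
               finite_set [set x | d x != 0] &
               \sum_(x \in [set: X]) d x = 1]].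

(* [f, h], meaningful for h of finite support. *)
Definition pairing (R : realType) (X : choiceType) (f h : X -> R) : R :=
  \sum_(x \in [set: X]) f x * h x.

(* Contents in the library live on pointed types with a chosen semiring of
   sets; here the domain is the whole power set of an arbitrary type. *)
Definition fa_probability (R : realType) (T : Type) (m : set T -> R) : Prop :=
  [/\ forall A, 0 <= m A,
      m [set: T] = 1 &
      forall A B, A `&` B = set0 -> m (A `|` B) = m A + m B].

(* Since m is finite and defined on all subsets, the simple functions are the
   functions with finite image, and all of them are m-integrable. *)
Definition simple_integral (R : realType) (T : Type) (m : set T -> R)
    (s : T -> R) : R :=
  \sum_(r \in range s) r * m (s @^-1` [set r]).

(* Dunford-Schwartz: s is a determining sequence for f, i.e. the simple
   functions s n converge to f in m-measure and are Cauchy in mean.  The outer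
   measure used in general to define convergence in measure is m itself here. *)
Definition ds_determining (R : realType) (T : Type) (m : set T -> R)
    (f : T -> R) (s : nat -> {fimfun T >-> R}) : Prop :=
  (forall e : R, 0 < e ->
     m [set t | e < `|s n t - f t|] @[n --> \oo] --> (0 : R)) /\
  simple_integral m (fun t => `|s p.1 t - s p.2 t|)
    @[p --> (\oo, \oo)] --> (0 : R).

Definition ds_integrable (R : realType) (T : Type) (m : set T -> R)
    (f : T -> R) : Prop :=
  exists s, ds_determining m f s.

(* The common limit of the integrals along determining sequences (0 if f is not
   integrable). *)
Definition ds_integral (R : realType) (T : Type) (m : set T -> R)
    (f : T -> R) : R :=
  xget 0 [set l : R | exists s, ds_determining m f s /\
    simple_integral m (s n) @[n --> \oo] --> l].

(* P(F; E(X)); the elements of the subtype F are functions, and m is defined on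
   every subset of F. *)
Definition fa_prob_eval (R : realType) (X : choiceType) (F : set (X -> R)) :
    set (set F -> R) :=
  [set m | fa_probability m /\
    forall x, ds_integrable m (fun f : F => \val f x)].

(* Main.v *)
Require Import Defs.
From HB Require Import structures.
From mathcomp Require Import all_boot all_order all_algebra.
From mathcomp Require Import all_classical all_reals all_analysis.
From mathcomp Require Import ring lra zify.

Set Implicit Arguments.
Unset Strict Implicit.
Unset Printing Implicit Defensive.

Import Order.TTheory GRing.Theory Num.Theory.
Import numFieldNormedType.Exports.

Local Open Scope classical_set_scope.
Local Open Scope ring_scope.

(** If m dominates G, approximating the finitely many evaluations involved by
    simple functions shows that the m-average of [f, h] is at most its supremum
    over F, which gives the inequality.

    Conversely, Hahn-Banach on the simple functions on F yields m such that a
    simple function above a nonnegative combination of the functions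
    f |-> f(x) - g(x), g in G, has nonnegative integral.  This works as soon as
    no such combination is bounded above by a negative constant.  Evaluations
    are bounded above, so they are limits in measure of decreasing simple
    functions lying above them; the integrals of these are at least g(x), which
    bounds the mass of {f(x) < -n} by O(1/n) and makes f |-> f(x) integrable.

    The hypothesis concerns sets of distinct pairs, without weights.  Weights
    are obtained from repetitions, by rounding up, and repetitions from distinct
    pairs, by moving a little mass off each Dirac measure; when X is a point
    the inequality for single pairs suffices. *)

(** * Integrals of simple functions *)

Section fimfun_lmod.
Variables (T : Type) (R : realType).

(** Makes the simple functions a vector space, the one on which Hahn-Banach is used. *)
Lemma fimfun_scaler_closed : GRing.scaler_closed (@fimfun T R).
Proof.
move=> a f; rewrite !inE /= => fin.
apply: sub_finite_set (finite_image (fun x => a * x) fin).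
by move=> _ [x _ <-]; exists (f x); first exists x.
Qed.

HB.instance Definition _ :=
  GRing.isScaleClosed.Build R (T -> R) (@fimfun T R) fimfun_scaler_closed.
HB.instance Definition _ := [SubZmodule_isSubLmodule of {fimfun T >-> R} by <:].

End fimfun_lmod.

Lemma finite_range_indic (R : realType) (T : Type) (A : set T) :
  finite_set (range (\1_A : T -> R)).
Proof.
apply: (@sub_finite_set _ _ [set 0; 1]) => [_ [t _ <-]|];
  last exact: finite_set2.
by rewrite indicE; case: (t \in A); [right|left].
Qed.

Definition fimfun_of_finite (R : Type) (T : Type) (f : T -> R)
    (fin : finite_set (range f)) : {fimfun T >-> R} :=
  HB.pack f (FiniteImage.Build _ _ f fin).

Lemma fimfun_bounded (R : realType) (T : Type) (s : {fimfun T >-> R}) :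
  exists2 C, 0 <= C & forall t, `|s t| <= C.
Proof.
have [r rE] := (finite_seqP _).1 (fimfunP s).
exists (\big[Num.max/0]_(y <- r) `|y|).
  by elim/big_rec: _ => // y M _ M0; rewrite le_max M0 orbT.
move=> t; apply: (le_bigmax_seq 0 (s t) xpredT) => //.
by have : range s (s t) by [exists t]; rewrite rE.
Qed.

Section finitely_additive.
Variables (R : realType) (T : Type) (m : set T -> R).
Hypothesis fam : fa_probability m.

Lemma fam_set0 : m set0 = 0.
Proof.
case: fam => _ _ /(_ set0 set0); rewrite setI0 setU0 => /(_ erefl); lra.
Qed.

Lemma fam_le A B : A `<=` B -> m A <= m B.
Proof.
case: fam => m0 _ mU AB; have -> : B = A `|` (B `\` A) by rewrite setDUK.
by rewrite mU ?setDIK// lerDl.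
Qed.

Lemma fam_leU A B : m (A `|` B) <= m A + m B.
Proof.
rewrite -(@setDUK _ A (A `|` B)); last exact: subsetUl.
case: (fam) => _ _ ->; last by rewrite setDIK.
by rewrite lerD2l fam_le// => t [[]].
Qed.

Lemma fam_preimage (K : choiceType) (h : T -> K) (r : seq K) : uniq r ->
  m [set t | h t \in r] = \sum_(k <- r) m (h @^-1` [set k]).
Proof.
case: (fam) => _ _ mU; elim: r => [|k r IH] /=.
  by rewrite big_nil (_ : [set _ | _] = set0) ?fam_set0// -subset0 => t.
move=> /andP[kr ur]; rewrite big_cons -IH// -mU.
  congr m; apply/seteqP; split=> t /=; rewrite inE.
    by move=> /orP[/eqP|] ?; [left|right].
  by move=> [->|->]; rewrite ?eqxx ?orbT.
by rewrite -subset0 => t /= [->]; rewrite (negbTE kr).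
Qed.

(** The level sets of [h] refine those of [w \o h]; grouping them by the value of [w] leaves the sum
    over the range. *)
Lemma simple_integral_comp (K : choiceType) (h : T -> K) (w : K -> R)
    (r : seq K) : uniq r -> (forall t, h t \in r) ->
  simple_integral m (w \o h) = \sum_(k <- r) w k * m (h @^-1` [set k]).
Proof.
move=> ur hr; rewrite /simple_integral.
pose r' := undup [seq w k | k <- r].
rewrite (@fsbig_widen _ _ _ _ _ [set` r']); first last.
- move=> y /= [_ yNr]; rewrite [_ @^-1` _](_ : _ = set0) ?fam_set0 ?mulr0//.
  by rewrite -subset0 => t ty; apply: yNr; exists t.
- by move=> _ [t _ <-] /=; rewrite mem_undup map_f.
rewrite -fsbig_seq ?undup_uniq//.
transitivity (\sum_(y <- r') \sum_(k <- r | w k == y)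
    w k * m (h @^-1` [set k])).
  apply: eq_bigr => y _.
  transitivity (y * m [set t | h t \in [seq k <- r | w k == y]]).
    congr (_ * m _); apply/seteqP; split=> t /=; rewrite mem_filter hr andbT.
      by move=> ->.
    by move=> /eqP.
  rewrite fam_preimage ?filter_uniq// big_filter mulr_sumr.
  by apply: eq_bigr => k /eqP ->.
rewrite (exchange_big_dep xpredT)//=; apply: eq_big_seq => k kr.
have wkr : w k \in r' by rewrite mem_undup map_f.
rewrite big_mkcond (bigD1_seq (w k)) ?undup_uniq//= eqxx big1 ?addr0// => y.
by rewrite eq_sym => /negbTE ->.
Qed.

(** A partition common to [f] and [g]: it makes linearity and monotonicity of the integral
    termwise. *)
Lemma simple_integral_pair (f g : {fimfun T >-> R}) :
  exists2 r : seq (R * R), uniq r & forall w : R * R -> R,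
    simple_integral m (fun t => w (f t, g t)) =
    \sum_(k <- r) w k * m [set t | (f t, g t) = k].
Proof.
have fin : finite_set (range (fun t => (f t, g t))).
  exact: (finite_image11 pair).
have [r rE] := (finite_seqP _).1 fin.
exists (undup r); first exact: undup_uniq.
move=> w; rewrite -(@simple_integral_comp _ (fun t => (f t, g t)) w (undup r)).
- by [].
- exact: undup_uniq.
- move=> t; rewrite mem_undup.
  by have : range (fun t => (f t, g t)) (f t, g t) by [exists t]; rewrite rE.
Qed.

Lemma simple_integralD (f g : {fimfun T >-> R}) :
  simple_integral m (f \+ g) = simple_integral m f + simple_integral m g.
Proof.
have [r ur E] := simple_integral_pair f g.
rewrite (E (fun k => k.1 + k.2)) (E fst) (E snd) -big_split/=.
by apply: eq_bigr => k _; rewrite mulrDl.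
Qed.

Lemma simple_integralZ c (f : {fimfun T >-> R}) :
  simple_integral m (fun t => c * f t) = c * simple_integral m f.
Proof.
have [r ur E] := simple_integral_pair f f.
rewrite (E (fun k => c * k.1)) (E fst) mulr_sumr.
by apply: eq_bigr => k _; rewrite mulrA.
Qed.

Lemma simple_integral_le (f g : {fimfun T >-> R}) : (forall t, f t <= g t) ->
  simple_integral m f <= simple_integral m g.
Proof.
move=> fg; have [r ur E] := simple_integral_pair f g.
rewrite (E fst) (E snd); apply: ler_sum => k _.
(* [k.1 <= k.2] is only known when the level set has a point; otherwise its mass is 0. *)
have [->|/set0P[t <-]] := eqVneq [set t | (f t, g t) = k] set0.
  by rewrite fam_set0 !mulr0.
by case: fam => m0 _ _; apply: ler_wpM2r; [exact: m0|exact: fg].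
Qed.

Lemma simple_integral_indic (A : set T) : simple_integral m \1_A = m A.
Proof.
rewrite (_ : \1_A = (fun b : bool => b%:R) \o (fun t => t \in A)) //.
rewrite (@simple_integral_comp _ _ _ [:: true; false])//; last by move=> t;
  case: (t \in A).
rewrite big_cons big_seq1 mul1r mul0r addr0; congr m.
by apply/seteqP; split=> t; [exact: set_mem|exact: mem_set].
Qed.

Lemma simple_integral_cst c : simple_integral m (cst c) = c.
Proof.
rewrite (@simple_integral_comp _ (fun=> tt) (fun=> c) [:: tt])//.
rewrite big_seq1 (_ : _ @^-1` _ = setT); last by apply/seteqP.
by case: fam => _ -> _; rewrite mulr1.
Qed.

End finitely_additive.

(** * Hahn-Banach *)

(** Gives subadditivity of functionals defined as infima. The bound [b] keeps [inf C] away from its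
    default value. *)
Lemma inf_le_addr (R : realType) (A B C : set R) (b : R) :
  A !=set0 -> B !=set0 -> lbound C b ->
  (forall x y, A x -> B y -> exists2 z, C z & z <= x + y) ->
  inf C <= inf A + inf B.
Proof.
move=> A0 B0 Cb ABC; rewrite -lerBlDr; apply: lb_le_inf => // x Ax.
rewrite lerBlDr addrC -lerBlDr; apply: lb_le_inf => // y By.
have [z Cz zxy] := ABC _ _ Ax By.
by rewrite lerBlDr addrC (le_trans _ zxy)//; apply: ge_inf => //; exists b.
Qed.

(** Homogeneity is required as an inequality only, which is easier to check for infima; [sublinearZ]
    recovers equality. *)
Definition sublinear (R : realType) (V : lmodType R) (p : V -> R) :=
  (forall u v, p (u + v) <= p u + p v) /\
  (forall c u, 0 <= c -> p (c *: u) <= c * p u).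

Section hahn_banach.
Variables (R : realType) (V : lmodType R).
Implicit Types (p q : V -> R) (u v : V).

Lemma sublinear0 p : sublinear p -> p 0 = 0.
Proof.
move=> [pD pZ]; have := pD 0 0; have := pZ 0 0 (lexx 0).
rewrite addr0 scale0r mul0r => ? ?; lra.
Qed.

Lemma sublinearN p u : sublinear p -> - p (- u) <= p u.
Proof. by move=> sp; have := sp.1 u (- u); rewrite subrr sublinear0//; lra. Qed.

Lemma sublinearZ p c u : sublinear p -> 0 <= c -> p (c *: u) = c * p u.
Proof.
move=> sp; rewrite le_eqVlt => /predU1P[<-|c0].
  by rewrite scale0r sublinear0// mul0r.
apply/eqP; rewrite eq_le sp.2 ?(ltW c0)//=.
have := sp.2 c^-1 (c *: u); rewrite invr_ge0 (ltW c0) => /(_ isT).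
by rewrite scalerA mulVf ?gt_eqF// scale1r ler_pdivlMl.
Qed.

(* A minimal sublinear functional is linear: it cannot exceed its infimal
   decrease [u |-> inf_(t >= 0) p (u + t v) - t p v] along any direction v. *)
Lemma minimal_sublinear_superadditive p : sublinear p ->
  (forall q, sublinear q -> (forall u, q u <= p u) -> q = p) ->
  forall u v, p u + p v <= p (u + v).
Proof.
move=> sp pmin u v.
pose A w := [set p (w + t *: v) - t * p v | t in [set t : R | 0 <= t]].
have A0 w : A w !=set0 by exists (p (w + 0 *: v) - 0 * p v); exists 0 => /=.
have Ab w : lbound (A w) (- p (- w)).
  move=> _ [t /= t0 <-]; have := sp.1 (w + t *: v) (- w).
  by rewrite addrAC subrr add0r sublinearZ//; lra.
have Ale w r : A w r -> inf (A w) <= r.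
  by move=> Ar; apply: ge_inf => //; exists (- p (- w)).
have Ep : (fun w => inf (A w)) = p.
  apply: pmin; last first.
    move=> w; apply: Ale; exists 0 => /=; first by [].
    by rewrite scale0r addr0 mul0r subr0.
  split=> [w w'|c w c0].
    apply: (@inf_le_addr _ _ _ _ (- p (- (w + w')))) => //.
    move=> _ _ [t /= t0 <-] [t' /= t'0 <-].
    exists (p (w + w' + (t + t') *: v) - (t + t') * p v).
      by exists (t + t') => //=; rewrite addr_ge0.
    by have := sp.1 (w + t *: v) (w' + t' *: v); rewrite addrACA -scalerDl; lra.
  move: c0; rewrite le_eqVlt => /predU1P[<-|c0].
    rewrite scale0r mul0r; apply: Ale; exists 0 => //=.
    by rewrite scale0r addr0 mul0r subr0 sublinear0.
  rewrite mulrC -ler_pdivrMr//; apply: lb_le_inf => // _ [t /= t0 <-].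
  rewrite ler_pdivrMr//; apply: Ale; exists (c * t) => /=.
    by rewrite mulr_ge0// (ltW c0).
  by rewrite -scalerA -scalerDr sublinearZ// ?(ltW c0)//; ring.
(* Minimality has identified the infimum with [p u]; the member of [A u] at [t = 1] is
   [p (u + v) - p v]. *)
have := Ale u (p (u + v) - p v).
rewrite (congr1 (@^~ u) Ep) => H; rewrite -lerBrDr H//.
by exists 1 => /=; [|rewrite scale1r mul1r].
Qed.

(** Zorn for the reversed pointwise order: the pointwise infimum of a chain is sublinear, and finite
    because [- q (- u)] bounds every member from below. *)
Lemma minimal_sublinear_exists q : sublinear q ->
  exists p, [/\ sublinear p, forall u, p u <= q u &
    forall p', sublinear p' -> (forall u, p' u <= p u) -> p' = p].
Proof.
move=> sq; pose S := {p | sublinear p /\ forall u, p u <= q u}.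
pose le (a b : S) := `[< forall u, sval b u <= sval a u >].
have [|a b c|a b|C Ctot|[p [sp pq]] pmin] := @Zorn S le.
- by move=> a; apply/asboolP.
- move=> ab bc; apply/asboolP => u; move/asboolP in ab; move/asboolP in bc.
  exact: le_trans (bc u) (ab u).
- case: a b => [a Pa] [b Pb] /asboolP/= ab /asboolP/= ba.
  by apply: eq_exist; apply/funext => u; apply/eqP; rewrite eq_le ab ba.
- have [->|/set0P[a0 Ca0]] := eqVneq C set0.
    by exists (exist _ q (conj sq (fun u => lexx _))).
  pose I u := [set sval a u | a in C].
  have I0 u : I u !=set0 by exists (sval a0 u); exists a0.
  have Ib u : lbound (I u) (- q (- u)).
    move=> _ [[p [sp pq]] Cp <-] /=.
    by apply: le_trans (sublinearN u sp); rewrite lerN2.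
  have Ile a u : C a -> inf (I u) <= sval a u.
    by move=> Ca; apply: ge_inf; [exists (- q (- u))|exists a].
  have sI : sublinear (fun u => inf (I u)).
    split=> [u v|c u c0].
      apply: (@inf_le_addr _ _ _ _ (- q (- (u + v)))) => //.
      move=> _ _ [a Ca <-] [b Cb <-].
      (* The smaller of [a] and [b] is used for both terms. *)
      have [/asboolP ab|/asboolP ba] := Ctot _ _ Ca Cb.
        exists (sval b (u + v)); first by exists b.
        by apply: le_trans ((svalP b).1.1 _ _) _; rewrite lerD2r.
      exists (sval a (u + v)); first by exists a.
      by apply: le_trans ((svalP a).1.1 _ _) _; rewrite lerD2l.
    move: c0; rewrite le_eqVlt => /predU1P[<-|c0].
      rewrite scale0r mul0r; apply: le_trans (Ile a0 _ Ca0) _.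
      by rewrite sublinear0//; exact: (svalP a0).1.
    rewrite mulrC -ler_pdivrMr//; apply: lb_le_inf => // _ [a Ca <-].
    rewrite ler_pdivrMr// mulrC; apply: le_trans (Ile a _ Ca) _.
    by apply: (svalP a).1.2; exact: ltW.
  have Iq u : inf (I u) <= q u.
    by apply: le_trans (Ile a0 u Ca0) ((svalP a0).2 u).
  exists (exist _ (fun u => inf (I u)) (conj sI Iq) : S) => a Ca;
    apply/asboolP => u /=.
  exact: Ile.
- exists p; split => // p' sp' p'p.
  have p'q u : p' u <= q u by apply: le_trans (pq u).
  have /pmin : le (exist _ p (conj sp pq)) (exist _ p' (conj sp' p'q)).
    exact/asboolP.
  by case.
Qed.

(** There is no extension step: superadditivity makes a minimal sublinear functional additive, hence
    odd, hence linear. *)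
Theorem hahn_banach q : sublinear q ->
  exists L : V -> R, [/\ forall u v, L (u + v) = L u + L v,
    forall c u, L (c *: u) = c * L u & forall u, L u <= q u].
Proof.
move=> /minimal_sublinear_exists[L [sL Lq Lmin]].
have LD u v : L (u + v) = L u + L v.
  apply/eqP; rewrite eq_le sL.1/=.
  exact: minimal_sublinear_superadditive.
have LN u : L (- u) = - L u.
  by apply/eqP; rewrite -subr_eq0 opprK addrC -LD subrr sublinear0.
exists L; split => // c u; have [c0|c0] := leP 0 c; first exact: sublinearZ.
rewrite -[c]opprK scaleNr LN sublinearZ ?oppr_ge0 ?ltW//.
by rewrite !mulNr.
Qed.

End hahn_banach.

(** * The Dunford-Schwartz integral *)

Section dunford_schwartz.
Variables (R : realType) (T : Type) (m : set T -> R).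
Hypothesis fam : fa_probability m.
Implicit Types (f g : T -> R) (s : nat -> {fimfun T >-> R}).

Let norm_fimfun (u : {fimfun T >-> R}) : {fimfun T >-> R} := Num.norm \o u.

Lemma simple_integral_norm_ge0 (u : {fimfun T >-> R}) :
  0 <= simple_integral m (fun t => `|u t|).
Proof.
rewrite -(simple_integral_cst fam 0).
by apply: (@simple_integral_le _ _ _ fam (cst_fimfun 0) (norm_fimfun u))
  => t /=.
Qed.

Lemma simple_integral_dist (u v : {fimfun T >-> R}) :
  `|simple_integral m u - simple_integral m v| <=
  simple_integral m (fun t => `|u t - v t|).
Proof.
pose d := norm_fimfun (u - v).
have H1 : simple_integral m u <= simple_integral m (v \+ d).
  apply: (@simple_integral_le _ _ _ fam u (v + d)) => t /=.
  by rewrite -lerBlDl ler_norm.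
have H2 : simple_integral m v <= simple_integral m (u \+ d).
  apply: (@simple_integral_le _ _ _ fam v (u + d)) => t /=.
  by have := ler_norm (v t - u t); rewrite distrC lerBlDl.
move: H1 H2; rewrite !simple_integralD// => H1 H2.
rewrite ler_norml; have -> : (fun t => `|u t - v t|) = d by [].
by apply/andP; split; lra.
Qed.

Lemma ds_determiningP f s : ds_determining m f s <->
  (forall e, 0 < e -> m [set t | e < `|s n t - f t|] @[n --> \oo] --> (0 : R))
    /\
  (forall d, 0 < d -> exists N, forall n k, (N <= n)%N -> (N <= k)%N ->
    simple_integral m (fun t => `|s n t - s k t|) < d).
Proof.
split=> -[meas mean]; split=> //.
  move=> d d0; move/cvgrPdist_lt : mean => /(_ _ d0).
  move=> [[A B] /= [[N _ NA] [M _ MB]] AB].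
  exists (maxn N M) => n k; rewrite !geq_max => /andP[Nn Mn] /andP[Nk Mk].
  have := AB (n, k) (conj (NA _ Nn) (MB _ Mk)).
  by rewrite /= sub0r normrN; apply: le_lt_trans; rewrite ler_norm.
apply/cvgrPdist_lt => d d0; have [N HN] := mean _ d0.
exists ([set n | (N <= n)%N], [set n | (N <= n)%N]) => /=.
  by split; exists N.
move=> [n k] /= [Nn Nk]; rewrite sub0r normrN ger0_norm ?HN//.
exact: (simple_integral_norm_ge0 (s n - s k)).
Qed.

Lemma ds_determiningD f g s s' :
  ds_determining m f s -> ds_determining m g s' ->
  ds_determining m (f \+ g) (fun n => s n + s' n).
Proof.
move=> /ds_determiningP[m1 c1] /ds_determiningP[m2 c2].
apply/ds_determiningP; split=> [e e0|d d0].
  have e20 : 0 < e / 2 by lra.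
  have m0 : m [set t | e / 2 < `|s n t - f t|] +
      m [set t | e / 2 < `|s' n t - g t|] @[n --> \oo] --> (0 : R).
    by rewrite -[0]addr0; exact: cvgD (m1 _ e20) (m2 _ e20).
  apply: (@squeeze_cvgr _ _ _ _ (cst 0) _ _ _ 0 _ m0); last exact: cvg_cst.
  near=> n.
  case: (fam) => -> _ _ /=; apply: le_trans (fam_leU fam _ _).
  apply: fam_le => // t /= et.
  have [|st] := ltP (e / 2) `|s n t - f t|; [by left|right].
  by have := ler_normD (s n t - f t) (s' n t - g t); rewrite addrACA -opprD;
    lra.
have [|N1 H1] := c1 (d / 2); first lra.
have [|N2 H2] := c2 (d / 2); first lra.
exists (maxn N1 N2) => n k; rewrite !geq_max => /andP[n1 n2] /andP[k1 k2].
have {H1} := H1 _ _ n1 k1; have {H2} := H2 _ _ n2 k2.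
pose u := norm_fimfun (s n - s k); pose v := norm_fimfun (s' n - s' k).
have := simple_integralD fam u v.
have : simple_integral m (fun t => `|(s n + s' n) t - (s k + s' k) t|) <=
       simple_integral m (u \+ v).
  apply: (@simple_integral_le _ _ _ fam
    (norm_fimfun ((s n + s' n) - (s k + s' k))) (u + v)) => t /=.
  by rewrite opprD addrACA ler_normD.
by rewrite /u /v /norm_fimfun/=; lra.
Unshelve. all: by end_near. Qed.

Lemma ds_determiningZ c f s : ds_determining m f s ->
  ds_determining m (fun t => c * f t) (fun n => c *: s n).
Proof.
(* Dividing by [|c| + 1] instead of [|c|] covers [c = 0]. *)
have c0 : 0 < `|c| + 1 by rewrite ltr_wpDl.
move=> /ds_determiningP[meas mean]; apply/ds_determiningP; split=> [e e0|d d0].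
  have {}e0 : 0 < e / (`|c| + 1) by rewrite divr_gt0.
  apply: (@squeeze_cvgr _ _ _ _ (cst 0) _ _ _ 0 _ (meas _ e0));
    last exact: cvg_cst.
  near=> n.
  case: (fam) => -> _ _ /=; apply: fam_le => // t /= et.
  rewrite ltr_pdivrMr// (lt_le_trans et)//.
  by rewrite -mulrBr normrM mulrC ler_wpM2l// lerDl.
have [|N HN] := mean (d / (`|c| + 1)); first by rewrite divr_gt0.
exists N => n k Nn Nk; have {HN} := HN _ _ Nn Nk; rewrite ltr_pdivlMr//.
apply: le_lt_trans.
rewrite (_ : (fun t => _) = fun t => `|c| * norm_fimfun (s n - s k) t).
  rewrite simple_integralZ// mulrC ler_wpM2l// ?lerDl//.
  exact: simple_integral_norm_ge0.
by apply/funext => t /=; rewrite -normrM mulrBr.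
Unshelve. all: by end_near. Qed.

(** Linearity, stated for sequences with given limits so that it is available before the limit is
    known to be independent of the sequence. *)
Lemma ds_determining_sum (I : Type) (r : seq I) (c : I -> R) (f : I -> T -> R)
    (s : I -> nat -> {fimfun T >-> R}) (a : I -> R) :
  (forall i, ds_determining m (f i) (s i)) ->
  (forall i, simple_integral m (s i n) @[n --> \oo] --> a i) ->
  ds_determining m (fun t => \sum_(i <- r) c i * f i t)
    (fun n => \sum_(i <- r) c i *: s i n) /\
  simple_integral m (\sum_(i <- r) c i *: s i n) @[n --> \oo]
    --> \sum_(i <- r) c i * a i.
Proof.
move=> det lim; elim: r => [|i r [IHd IHl]].
  under eq_fun do rewrite big_nil.
  under [X in ds_determining _ _ X]eq_fun do rewrite big_nil.
  under [X in X @ _]eq_fun do rewrite big_nil.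
  rewrite big_nil; split; last first.
    by rewrite (simple_integral_cst fam 0); exact: cvg_cst.
  apply/ds_determiningP; split=> [e e0|d d0].
    rewrite (_ : [set _ | _] = set0) ?fam_set0//; first exact: cvg_cst.
    by rewrite -subset0 => t /=; rewrite subrr normr0 => /(lt_trans e0);
      rewrite ltxx.
  exists 0 => n k _ _;
    rewrite (_ : (fun t => _) = cst 0) ?simple_integral_cst//.
  by apply/funext => t; rewrite subrr normr0.
under eq_fun do rewrite big_cons.
under [X in ds_determining _ _ X]eq_fun do rewrite big_cons.
under [X in X @ _]eq_fun do
  rewrite big_cons simple_integralD// simple_integralZ//.
split; first by apply: ds_determiningD => //; exact: ds_determiningZ.
by rewrite big_cons; apply: cvgD => //; exact: cvgMr.
Qed.

(** Off the set [A] where [s n] exceeds the error [e / 4], [s n] is at most [b + e / 4]. On [A] it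
    is compared with a fixed [s N], bounded by [b + C]: the distance to [s N] is small in mean, and
    [C * m A] tends to 0 because [C] depends on [N] only. *)
Lemma ds_determining_lim_le f s a b : ds_determining m f s ->
  simple_integral m (s n) @[n --> \oo] --> a -> (forall t, f t <= b) -> a <= b.
Proof.
move=> /ds_determiningP[meas mean] sa fb; apply/ler_addgt0Pr => e e0.
have e40 : 0 < e / 4 by lra.
have [N HN] := mean _ e40.
have [C C0 sC] : exists2 C, 0 <= C & forall t, s N t <= b + C.
  have [C C0 sC] := fimfun_bounded (s N); exists (C + `|b|).
    by rewrite addr_ge0.
  move=> t; have := sC t; have := ler_norm (s N t); have := ler_norm (- b).
  by rewrite normrN; lra.
rewrite -(cvg_lim _ sa)//; apply: limr_le; first by apply/cvg_ex; exists a.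
have : C * m [set t | e / 4 < `|s n t - f t|] @[n --> \oo] --> (0 : R).
  by rewrite -(mulr0 C); apply: cvgMr; exact: meas.
move=> /cvgr_lt/(_ _ e40) small.
near=> n.
have nN : (N <= n)%N by near: n; exists N.
have mA : C * m [set t | e / 4 < `|s n t - f t|] < e / 4.
  by near: n; exact: small.
pose A := [set t | e / 4 < `|s n t - f t|].
pose d := norm_fimfun (s n - s N).
pose i := fimfun_of_finite (finite_range_indic R A).
have : simple_integral m (s n) <=
    simple_integral m (cst_fimfun (b + e / 4) \+ (d + C *: i)).
  apply: (@simple_integral_le _ _ _ fam (s n) (cst_fimfun _ + (d + C *: i)))
    => t.
  change (s n t <= b + e / 4 + (`|s n t - s N t| + C * (t \in A)%:R)).
  have [tA|/negP] := boolP (t \in A).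
    have := ler_norm (s n t - s N t); have := sC t; rewrite mulr1; lra.
  have := normr_ge0 (s n t - s N t); rewrite inE /A/= => ? /negP.
  by rewrite -leNgt mulr0 => ?; have := ler_norm (s n t - f t); have := fb t;
    lra.
rewrite !simple_integralD// simple_integralZ// simple_integral_indic//.
rewrite simple_integral_cst//; have := HN _ _ nN (leqnn _).
by rewrite /d/=; lra.
Unshelve. all: by end_near. Qed.

(** The previous bound applied to [f - g], written as a sum over [bool] with coefficients 1 and
    -1. *)
Lemma ds_determining_le f g s s' a b :
  ds_determining m f s -> simple_integral m (s n) @[n --> \oo] --> a ->
  ds_determining m g s' -> simple_integral m (s' n) @[n --> \oo] --> b ->
  (forall t, f t <= g t) -> a <= b.
Proof.
move=> fs sa gs' s'b fg.
have [||det lim] := @ds_determining_sum bool [:: true; false]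
  (fun i => if i then 1 else -1)
  (fun i => if i then f else g) (fun i => if i then s else s')
  (fun i => if i then a else b).
- by case.
- by case.
have ab : \sum_(i <- [:: true; false]) (if i then 1 else -1) *
  (if i then a else b) <= 0.
  apply: (ds_determining_lim_le det lim) => t.
  by rewrite !big_cons big_nil mul1r mulN1r addr0 subr_le0.
by move: ab; rewrite !big_cons big_nil mul1r mulN1r addr0 subr_le0.
Qed.

(** The integrals along a determining sequence are Cauchy, hence convergent, so [xget] does not
    return its default 0. *)
Lemma ds_integralP f : ds_integrable m f -> exists2 s, ds_determining m f s &
  simple_integral m (s n) @[n --> \oo] --> ds_integral m f.
Proof.
move=> [s fs].
suff /cvg_ex[l sl] : cvgn (fun n => simple_integral m (s n)).
  have := @xgetI R 0 [set l : R | exists s, ds_determining m f s /\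
    simple_integral m (s n) @[n --> \oo] --> l] l (ex_intro _ s (conj fs sl)).
  by move=> [s' [fs' s'l]]; exists s'.
apply/cauchy_cvgP/cauchyP => e e0.
have [_ /(_ _ e0)[N HN]] := (ds_determiningP f s).1 fs.
exists (simple_integral m (s N)); exists N => // n /= Nn.
rewrite /ball/=; apply: le_lt_trans (HN _ _ (leqnn _) Nn).
exact: simple_integral_dist.
Qed.

(** Independence of the sequence: monotonicity is applied to [f <= f] in both directions. *)
Lemma ds_integral_eq f s a : ds_determining m f s ->
  simple_integral m (s n) @[n --> \oo] --> a -> ds_integral m f = a.
Proof.
move=> fs sa; have [|s' fs' s'i] := @ds_integralP f; first by exists s.
apply/eqP; rewrite eq_le.
by rewrite (ds_determining_le fs' s'i fs sa)//=
  (ds_determining_le fs sa fs' s'i).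
Qed.

End dunford_schwartz.

(** * Existence of dominating probabilities *)

(** [q u] is the infimum of the constants above some [u + k] with [k] in [K]. It is finite because
    no element of [K] lies below a negative constant, and sublinear because [K] is a convex cone. A
    linear [L] below [q], restricted to indicators, is the required [m]. *)
Lemma cone_separation (R : realType) (T : Type) (K : set (T -> R)) :
  K (cst 0) -> (forall k k', K k -> K k' -> K (k \+ k')) ->
  (forall c k, 0 <= c -> K k -> K (fun t => c * k t)) ->
  (forall k r, K k -> (forall t, k t <= r) -> 0 <= r) ->
  exists2 m : set T -> R, fa_probability m &
    forall k (s : {fimfun T >-> R}), K k -> (forall t, k t <= s t) ->
      0 <= simple_integral m s.
Proof.
move=> K0 KD KZ Kpos.
pose A (u : {fimfun T >-> R}) :=
  [set r | exists2 k, K k & forall t, u t + k t <= r].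
pose q u := inf (A u).
have Ab u : exists b, lbound (A u) b.
  have [C C0 uC] := fimfun_bounded u; exists (- C) => r [k Kk uk].
  rewrite lerNl -subr_ge0 opprK addrC; apply: (Kpos k) => // t.
  by have := uk t; have := uC t; rewrite ler_norml; lra.
have A0 u : A u !=set0.
  have [C C0 uC] := fimfun_bounded u; exists C, (cst 0) => // t.
  by rewrite addr0; apply: le_trans (uC t); rewrite ler_norm.
have qle u r : A u r -> q u <= r.
  by move=> Ar; apply: ge_inf => //; exact: Ab.
have sq : sublinear q.
  split=> [u v|c u].
    have [b Abb] := Ab (u + v); apply: inf_le_addr Abb _ => // x y.
    move=> [k Kk uk] [k' Kk' vk']; exists (x + y) => //.
    exists (k \+ k'); first exact: KD.
    by move=> t /=; rewrite addrACA lerD.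
  rewrite le_eqVlt => /predU1P[<-|c0].
    rewrite scale0r mul0r; apply: qle; exists (cst 0) => // t.
    by rewrite addr0.
  rewrite mulrC -ler_pdivrMr//; apply: lb_le_inf => // r [k Kk uk].
  rewrite ler_pdivrMr//; apply: qle; exists (fun t => c * k t).
    by apply: KZ => //; exact: ltW.
  move=> t; change (c * u t + c * k t <= r * c).
  by rewrite -mulrDr mulrC ler_pM2r.
have [L [LD LZ Lq]] := hahn_banach sq.
have LN u : L (- u) = - L u by rewrite -scaleN1r LZ mulN1r.
(* If [k <= s], then [- s + k <= 0], hence [q (- s) <= 0]. *)
have Lge k (s : {fimfun T >-> R}) : K k -> (forall t, k t <= s t) -> 0 <= L s.
  move=> Kk ks; rewrite -oppr_le0 -LN; apply: le_trans (Lq _) _.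
  by apply: qle; exists k => // t; rewrite /= addrC subr_le0.
pose I B := fimfun_of_finite (@finite_range_indic R T B).
pose m B := L (I B).
exists m; last first.
  (* [s] is the sum of its values times the indicators of its level sets, so [L] integrates it
     against [m]. *)
  move=> k s Kk ks; rewrite (_ : simple_integral m s = L s); last first.
    rewrite /simple_integral fsbig_finite//=.
    set r := finmap.enum_fset _.
    transitivity (L (\sum_(y <- r) y *: I (s @^-1` [set y]))).
      rewrite (big_morph L LD (_ : L 0 = 0)).
        by apply: eq_bigr => y _; rewrite LZ.
      by rewrite -(scale0r 0) LZ mul0r.
    congr L; apply/fimfuneqP => t.
    by rewrite fimfun_sum fimfunE fsbig_finite.
  exact: Lge Kk ks.
split.
- by move=> B; apply: (Lge (cst 0)).
- have E t : I [set: T] t = 1.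
    by change ((t \in [set: T])%:R = 1 :> R); rewrite in_setT.
  (* With [k = 0], [q] is at most 1 at the constant 1 and at most -1 at the constant -1. *)
  apply/eqP; rewrite eq_le; apply/andP; split.
    apply: le_trans (Lq _) _; apply: qle; exists (cst 0) => // t.
    by rewrite E addr0.
  rewrite -lerN2 -LN; apply: le_trans (Lq _) _.
  apply: qle; exists (cst 0) => // t.
  by change (- I [set: T] t + 0 <= -1); rewrite E addr0.
- move=> B C BC; rewrite /m -LD; congr L; apply/fimfuneqP => t.
  change ((t \in B `|` C)%:R = (t \in B)%:R + (t \in C)%:R :> R).
  have : ~ (t \in B /\ t \in C).
    by rewrite !inE => tBC; have : (B `&` C) t by []; rewrite BC.
  rewrite in_setU; case: (t \in B); case: (t \in C); rewrite ?addr0 ?add0r//=.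
  by case.
Qed.

(** * Simple approximations from above and integrability *)

Section upper_approximation.
Variables (R : realType) (n : nat).
Implicit Types y b : R.

(* Dyadic steps make this nonincreasing in n. *)
Definition round_up y : R :=
  Num.max (- n%:R) ((Num.floor (2 ^+ n * y) + 1)%:~R / 2 ^+ n).

Lemma round_up_ge y : y <= round_up y.
Proof.
rewrite /round_up le_max; apply/orP; right.
by rewrite ler_pdivlMr ?exprn_gt0// mulrC ltW// floorD1_gt.
Qed.

Lemma round_up_le y : round_up y <= Num.max (- n%:R) (y + 2 ^- n).
Proof.
rewrite /round_up ge_max !le_max lexx/=; apply/orP; right.
rewrite ler_pdivrMr ?exprn_gt0// mulrDl mulVf ?expf_neq0//.
by rewrite intrD lerD// mulrC floor_le.
Qed.

Lemma finite_round_up (T : Type) (f : T -> R) b : (forall t, f t <= b) ->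
  finite_set (range (round_up \o f)).
Proof.
move=> fb; pose K := Num.floor (2 ^+ n * b) + 1.
(* The numerators lie between [- n * 2 ^ n] and [K]; [j] measures the distance down from [K], which
   stays below [M]. *)
pose M := (`|K| + n * 2 ^ n).+1.
apply: (@sub_finite_set _ _ ([set - n%:R] `|`
  [set ((K - j%:Z)%:~R / 2 ^+ n) | j in `I_M])); last first.
  by rewrite finite_setU; split; [exact: finite_set1|exact: finite_image].
move=> _ [t _ <-]; rewrite /= /round_up.
set k := Num.floor (2 ^+ n * f t) + 1.
have [nk|] := leP (- n%:R) (k%:~R / 2 ^+ n : R); last by left.
right; have kK : k <= K.
  by rewrite lerD2r le_floor// ler_wpM2l ?exprn_ge0.
have Nk : - (n * 2 ^ n)%N%:Z <= k.
  move: nk; rewrite ler_pdivlMr ?exprn_gt0// -(ler_int R).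
  by rewrite mulrNz mulNr -natrX -natrM.
exists `|K - k|%N; last by rewrite gez0_abs ?subr_ge0// subKr.
rewrite /M; lia.
Qed.

End upper_approximation.

(** The grid of step [2 ^- n] is contained in the next one, so the first grid point strictly above
    [y] can only move down. *)
Lemma round_up_nonincreasing (R : realType) (y : R) :
  {homo (fun n => round_up n y) : n k / (n <= k)%N >-> k <= n}.
Proof.
apply/nonincreasing_seqP => n; rewrite /round_up.
rewrite ge_max !le_max lerN2 ler_nat leqnSn/=; apply/orP; right.
set k := Num.floor (2 ^+ n * y).
have -> : (k + 1)%:~R / 2 ^+ n = (2 * (k + 1))%:~R / 2 ^+ n.+1 :> R.
  by rewrite exprS intrM invfM mulrACA divff ?mul1r.
rewrite ler_pM2r ?invr_gt0 ?exprn_gt0// ler_int lezD1 floor_lt_int.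
by rewrite intrM exprS -mulrA ltr_pM2l// floorD1_gt.
Qed.

Section ds_integrable_above.
Variables (R : realType) (T : Type) (m : set T -> R).
Hypothesis fam : fa_probability m.
Variables (f : T -> R) (b c : R).
Hypothesis fb : forall t, f t <= b.
Hypothesis cf : forall s : {fimfun T >-> R}, (forall t, f t <= s t) ->
  c <= simple_integral m s.

Let s n : {fimfun T >-> R} := fimfun_of_finite (finite_round_up n fb).
Let sE n t : s n t = round_up n (f t). Proof. by []. Qed.

Let s_ge n t : f t <= s n t. Proof. exact: round_up_ge. Qed.

Let s_decr n k t : (n <= k)%N -> s k t <= s n t.
Proof. exact: round_up_nonincreasing. Qed.

Let s_cvg : cvgn (fun n => simple_integral m (s n)).
Proof.
apply: nonincreasing_is_cvgn.
  by move=> n k nk; apply: simple_integral_le => // t; exact: s_decr.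
by exists c => _ [n _ <-]; apply: cf.
Qed.

Let exp_le1 n : 2 ^- n <= 1 :> R.
Proof. by rewrite invf_le1 ?exprn_gt0// exprn_ege1// ler1n. Qed.

(** On the tail [s n] is at most [- n + 1], so adding [n + |b|] there keeps it below [|b| + 1].
    Integrating and using that [s n] has integral at least [c] gives the bound. *)
Let m_tail n : m [set t | f t < - n%:R] * n%:R <= `|b| + 1 - c.
Proof.
set A := [set t | _]; pose i := fimfun_of_finite (@finite_range_indic R T A).
have : simple_integral m (s n \+ (n%:R + `|b|) *: i) <= `|b| + 1.
  rewrite -[leRHS](simple_integral_cst fam).
  apply: (@simple_integral_le _ _ _ fam (s n + (n%:R + `|b|) *: i)
    (cst_fimfun _)) => t.
  change (s n t + (n%:R + `|b|) * (t \in A)%:R <= `|b| + 1).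
  have := round_up_le n (f t); rewrite -sE.
  have := exp_le1 n; have := ler_norm b; have := normr_ge0 b; have := fb t.
  have [tA|/negP tA] := boolP (t \in A).
    move: tA; rewrite inE /A/= => tA; rewrite mulr1 le_max => ? ? ? ? /orP[];
      lra.
  have n0 : 0 <= n%:R :> R by [].
  by rewrite mulr0 le_max => ? ? ? ? /orP[]; lra.
rewrite simple_integralD// simple_integralZ// simple_integral_indic//.
have := cf (s_ge n); have : 0 <= `|b| * m A; last by lra.
by case: fam => m0 _ _; rewrite mulr_ge0.
Qed.

Let s_det : ds_determining m f s.
Proof.
apply/(ds_determiningP fam); split=> [e e0|d d0]; last first.
  have /cauchy_cvgP/cauchyP/(_ (d / 2)) [|a [N _ HN]] := s_cvg; first by lra.
  exists N => n k Nn Nk.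
  wlog nk : n k Nn Nk / (n <= k)%N.
    move=> H; have [/H|/ltnW/H] := leqP n k; first exact.
    by under eq_fun do rewrite distrC; apply.
  (* By monotonicity the distance in mean is a difference of two integrals, each within [d / 2] of
     [a]. *)
  rewrite (_ : (fun t => _) = s n \+ (fun t => (-1) * s k t)).
    rewrite (@simple_integralD _ _ _ fam (s n) (-1 *: s k)) simple_integralZ//.
    have := HN _ Nn; have := HN _ Nk; rewrite /ball/= !ltr_norml; lra.
  by apply/funext => t /=; rewrite mulN1r ger0_norm// subr_ge0 s_decr.
apply/cvgrPdist_lt => d d0; near=> n.
rewrite sub0r normrN ger0_norm; last by case: fam.
have n0 : 0 < n%:R :> R by rewrite ltr0n; near: n; exists 1.
have ne : 2 ^- n <= e.
  have : e^-1 < n%:R by near: n; exact: nbhs_infty_gtr.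
  rewrite -[e in _ <= e]invrK lef_pV2 ?posrE ?exprn_gt0 ?invr_gt0// => /ltW en.
  by apply: le_trans en _; rewrite -natrX ler_nat ltnW// ltn_expl.
have nd : `|b| + 1 - c < d * n%:R.
  by rewrite mulrC -ltr_pdivrMr//; near: n; exact: nbhs_infty_gtr.
(* Where [f t >= - n], the rounding error is at most [2 ^- n <= e]; only the tail remains. *)
apply: (@le_lt_trans _ _ (m [set t | f t < - n%:R])).
  apply: fam_le => // t /=; rewrite ltNge => /negP; apply: contra_notP => /negP.
  rewrite -leNgt => tn; rewrite ger0_norm ?subr_ge0 ?s_ge// lerBlDl.
  apply: le_trans (round_up_le n (f t)) _; rewrite ge_max; apply/andP; split;
    first by lra.
  by rewrite lerD2l.
by rewrite -(ltr_pM2r n0); apply: le_lt_trans (m_tail n) nd.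
Unshelve. all: by end_near. Qed.

(** The integrals of the decreasing [s n] are bounded below by [c], hence converge, which makes [s]
    Cauchy in mean; [m_tail] gives convergence in measure. *)
Lemma ds_integrable_above : ds_integrable m f /\ c <= ds_integral m f.
Proof.
split; first by exists s; exact: s_det.
have /cvg_ex[l sl] := s_cvg; rewrite (ds_integral_eq fam s_det sl).
rewrite -(cvg_lim _ sl)//; apply: limr_ge; first by apply/cvg_ex; exists l.
by apply: nearW => n; exact: cf.
Qed.

End ds_integrable_above.

(** * From distinct pairs to weighted families *)

Section pairing.
Variables (R : realType) (X : choiceType).
Implicit Types (f h : X -> R).

Lemma pairingE f h (S : seq X) : uniq S -> (forall x, h x != 0 -> x \in S) ->
  pairing f h = \sum_(x <- S) f x * h x.
Proof.
move=> uS hS; rewrite /pairing -(@fsbig_widen _ _ _ _ [set` S] setT)//.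
  by rewrite -fsbig_seq.
move=> x /= [_ /negP xS]; apply/eqP; rewrite mulf_eq0; apply/orP; right.
by apply: contraNT xS => /hS.
Qed.

Lemma pairingD f h h' : finite_set [set x | h x != 0] ->
  finite_set [set x | h' x != 0] ->
  pairing f (h \+ h') = pairing f h + pairing f h'.
Proof.
move=> fh fh'; have /finite_seqP[r rE] : finite_set
  ([set x | h x != 0] `|` [set x | h' x != 0]) by rewrite finite_setU.
have inr x : h x != 0 \/ h' x != 0 -> x \in undup r.
  move=> hx; rewrite mem_undup.
  by have : ([set x | h x != 0] `|` [set x | h' x != 0]) x by []; rewrite rE.
rewrite !(@pairingE _ _ (undup r)) ?undup_uniq//.
- by rewrite -big_split/=; apply: eq_bigr => x _; rewrite mulrDr.
- by move=> x hx; apply: inr; right.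
- by move=> x hx; apply: inr; left.
- move=> x /=; have [->|hx] := eqVneq (h x) 0.
    by rewrite add0r => ?; apply: inr; right.
  by move=> _; apply: inr; left.
Qed.

(** The Dirac measure at [x] with a little mass moved to [y]; the amount [e] is a tag that tells
    repeated pairs apart. *)
Definition two_point (e : R) (x y : X) : X -> R :=
  fun z => (1 - e) * (z == x)%:R + e * (z == y)%:R.

Let finite_supp_dirac (c : R) (x : X) : finite_set [set z | c *
  (z == x)%:R != 0 :> R].
Proof.
apply: (@sub_finite_set _ _ [set x]); last exact: finite_set1.
by move=> z /=; have [//|_] := eqVneq z x; rewrite mulr0 eqxx.
Qed.

Lemma finite_supp_two_point e x y : finite_set [set z | two_point e x y z != 0].
Proof.
apply: (@sub_finite_set _ _ ([set x] `|` [set y])).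
  rewrite /two_point => z /=; have [|_] := eqVneq z x; first by left.
  have [|_] := eqVneq z y; first by right.
  by rewrite !mulr0 addr0 eqxx.
by rewrite finite_setU; split; exact: finite_set1.
Qed.

Lemma pairing_two_point f e x y :
  pairing f (two_point e x y) = (1 - e) * f x + e * f y.
Proof.
have D c z : pairing f (fun w => c * (w == z)%:R) = c * f z.
  rewrite (@pairingE _ _ [:: z])// ?big_seq1 ?eqxx ?mulr1 1?mulrC// => w.
  by rewrite inE; apply: contraNT => /negbTE ->; rewrite mulr0.
by rewrite (pairingD _ (finite_supp_dirac _ _) (finite_supp_dirac _ _)) !D.
Qed.

Lemma two_point_Delta e x y : 0 <= e <= 1 -> Delta (two_point e x y).
Proof.
move=> /andP[e0 e1]; split.
- by move=> z; rewrite addr_ge0// mulr_ge0// subr_ge0.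
- exact: finite_supp_two_point.
- have := pairing_two_point (cst 1) e x y; rewrite /pairing !mulr1 subrK => <-.
  by apply: eq_fsbigr => z _; rewrite mul1r.
Qed.

(** [x] is the only point of mass above one half, and its mass determines [e]. *)
Lemma two_point_inj e e' x x' y y' : x != y -> x' != y' ->
  0 <= e < 2^-1 -> 0 <= e' < 2^-1 ->
  two_point e x y = two_point e' x' y' -> e = e'.
Proof.
move=> xy xy' He He' /(congr1 (@^~ x)); rewrite /two_point eqxx (negbTE xy).
have [xx'|_] := eqVneq x x'; last by case: (x == y'); rewrite ?mulr0 ?mulr1;
  lra.
by rewrite -xx' in xy'; rewrite (negbTE xy') ?mulr0 ?mulr1; lra.
Qed.

Lemma pairing_sum (I : Type) (r : seq I) f (d : I -> X -> R) :
  (forall i, finite_set [set x | d i x != 0]) ->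
  pairing f (fun x => \sum_(i <- r) d i x) = \sum_(i <- r) pairing f (d i).
Proof.
move=> fd; elim: r => [|i r IH].
  rewrite big_nil (@pairingE _ _ [::]) ?big_nil// => x.
  by rewrite big_nil eqxx.
rewrite big_cons -IH -pairingD//.
  by congr pairing; apply/funext => x; rewrite big_cons.
elim: r {IH} => [|j r IH].
  by rewrite (_ : [set _ | _] = set0)// -subset0 => x /=; rewrite big_nil eqxx.
apply: (@sub_finite_set _ _ ([set x | d j x != 0] `|`
   [set x | \sum_(i <- r) d i x != 0])); last by rewrite finite_setU.
move=> x /=; rewrite big_cons; have [->|] := eqVneq (d j x) 0; last by left.
by rewrite add0r; right.
Qed.

End pairing.

Lemma ge0_perturb (R : realType) (r C : R) :
  (forall e, 0 < e -> e <= 1 -> 0 <= r + e * C) -> 0 <= r.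
Proof.
move=> H; have [//|r0] := leP 0 r.
have D0 : 0 < `|C| - r by rewrite subr_gt0 (lt_le_trans r0).
(* For this [e], [e * C] is at most [- r / 2], so [r + e * C] would be negative. *)
have e0 : 0 < - r / (`|C| - r) / 2 by rewrite !divr_gt0 ?oppr_gt0.
have e1 : - r / (`|C| - r) <= 1.
  by rewrite ler_pdivrMr// mul1r addrC lerDl.
have := H _ e0; have -> : - r / (`|C| - r) / 2 <= 1 by lra.
move=> /(_ isT).
have : - r / (`|C| - r) / 2 * C <= - r / 2.
  rewrite mulrAC ler_pM2r ?invr_gt0// mulrAC ler_pdivrMr//.
  by rewrite ler_pM2l ?oppr_gt0//; have := ler_norm C; lra.
lra.
Qed.

Section key_inequality.
Variables (R : realType) (X : choiceType) (F G : set (X -> R)).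
Hypothesis F_nonempty : F !=set0.
Hypothesis F_bounded : pointwise_upper_bounded F.
Hypothesis FG : forall A : set ((X -> R) * (X -> R)),
     finite_set A -> A `<=` G `*` @Delta R X ->
     ((\sum_(p \in A) pairing p.1 p.2)%:E <=
       ereal_sup [set (pairing f (fun x => \sum_(p \in A) p.2 x))%:E
                 | f in F])%E.

Lemma pointwise_ub : exists ub : X -> R, forall f x, F f -> f x <= ub x.
Proof.
exists (fun x => fine (ereal_sup [set (f x)%:E | f in F])) => f x Ff.
have H : ((f x)%:E <= ereal_sup [set (f x)%:E | f in F])%E.
  by apply: ereal_sup_ubound; exists f.
rewrite -lee_fin fineK// fin_numElt F_bounded andbT.
by rewrite (lt_le_trans _ H)// ltNyr.
Qed.

(** The hypothesis [FG] for indexed families; injectivity turns the sum over a set of pairs into a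
    sum over indices. *)
Lemma finite_family_le (I : finType) (g d : I -> X -> R) (r : R) :
  injective (fun i => (g i, d i)) -> (forall i, G (g i)) ->
  (forall i, Delta (d i)) ->
  (forall f, F f -> \sum_i pairing f (d i) <= r) ->
  \sum_i pairing (g i) (d i) <= r.
Proof.
move=> gd_inj Gg dD Fr; pose s := [seq (g i, d i) | i <- enum I].
have us : uniq s by rewrite map_inj_uniq ?enum_uniq.
have sum_s (E : (X -> R) * (X -> R) -> R) :
    \sum_(p \in [set` s]) E p = \sum_i E (g i, d i).
  by rewrite -fsbig_seq// big_map big_enum.
have := FG (A := [set` s]).
rewrite sum_s/= -lee_fin => H; apply: le_trans (H _ _) _.
- exact: finite_seq.
- by move=> _ /= /mapP[i _ ->]; split; [exact: Gg|exact: dD].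
apply: ub_ereal_sup => _ [f Ff <-]; rewrite lee_fin.
under eq_fun do rewrite sum_s /=.
by rewrite pairing_sum ?Fr// => i; case: (dD i).
Qed.

(** Index [i] moves its own mass [e * t i] from [x i] to the other point [o (x i)]. The pairs become
    distinct at a cost proportional to [e], which then tends to 0. *)
Lemma dirac_family_ge0_perturbed (o : X -> X) (I : finType) (g : I -> X -> R)
    (x : I -> X) (r : R) : (forall z, z != o z) -> (forall i, G (g i)) ->
  (forall f, F f -> \sum_i (f (x i) - g i (x i)) <= r) -> 0 <= r.
Proof.
move=> ox Gg Fr; have [ub Fub] := pointwise_ub.
(* Distinct values below one half, as [two_point_inj] requires; hence the shift by 3. *)
pose t (i : I) : R := (enum_rank i).+3%:R^-1.
have t0 i : 0 < t i by rewrite invr_gt0.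
have t1 i : t i < 2^-1 by rewrite ltf_pV2 ?posrE// ltr_nat.
(* Splitting [1 - e * t i] as [(1 - e) + e * (1 - t i)] leaves nonnegative weights in [W], so that
   [f] can be replaced by [ub] there. *)
pose W (v : I -> X -> R) := \sum_i ((1 - t i) * v i (x i) + t i * v i (o
  (x i))).
apply: (@ge0_perturb _ _ (W (fun=> ub) - W g - r)) => e e0 e1.
pose d i := two_point (e * t i) (x i) (o (x i)).
have et i : 0 <= e * t i < 2^-1.
  rewrite mulr_ge0 ?ltW//= (le_lt_trans _ (t1 i))//.
  by rewrite ler_piMl// ltW.
have sumd (v : I -> X -> R) : \sum_i pairing (v i) (d i) =
    (1 - e) * \sum_i v i (x i) + e * W v.
  rewrite !mulr_sumr -big_split/=; apply: eq_bigr => i _.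
  by rewrite pairing_two_point; ring.
have : \sum_i pairing (g i) (d i) <=
    (1 - e) * (r + \sum_i g i (x i)) + e * W (fun=> ub).
  apply: finite_family_le => //.
  - move=> i j [_ /two_point_inj]; rewrite !ox !et => /(_ isT isT isT isT).
    move=> /(mulfI (lt0r_neq0 e0))/invr_inj/eqP.
    by rewrite eqr_nat => /eqP[] /val_inj/enum_rank_inj.
  - move=> i; apply: two_point_Delta.
    by have /andP[-> /ltW/le_trans-> //] := et i; lra.
  - move=> f Ff; rewrite (sumd (fun=> f)) lerD//.
      apply: ler_wpM2l; first by rewrite subr_ge0.
      by have := Fr _ Ff; rewrite sumrB lerBlDr.
    rewrite ler_pM2l//; apply: ler_sum => i _.
    by rewrite lerD// ler_wpM2l ?Fub ?ltW// ?subr_ge0; have := t1 i; lra.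
by rewrite sumd; lra.
Qed.

(** Here no mass can be moved. All [x i] coincide, so [f (x i)] is at most [(S + r) / #|I|] on [F];
    single pairs transfer this bound to each [g i], and summing gives [S <= S + r]. *)
Lemma dirac_family_ge0_singleton (I : finType) (g : I -> X -> R)
    (x : I -> X) (r : R) : (forall z z' : X, z = z') -> (forall i, G (g i)) ->
  (forall f, F f -> \sum_i (f (x i) - g i (x i)) <= r) -> 0 <= r.
Proof.
move=> X1 Gg Fr; have [I0|/card_gt0P[i0 _]] := posnP #|I|.
  have [f Ff] := F_nonempty; have := Fr _ Ff.
  by rewrite big_pred0// => i; have := fintype0 i I0.
have n0 : 0 < #|I|%:R :> R by rewrite ltr0n; apply/card_gt0P; exists i0.
set S := \sum_i g i (x i).
suff : S <= S + r by rewrite lerDl.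
have gS i : g i (x i) <= (S + r) / #|I|%:R.
  have := @finite_family_le unit (fun=> g i) (fun=> two_point 0 (x i) (x i))
    ((S + r) / #|I|%:R).
  rewrite big_const card_unit /= pairing_two_point subr0 mul1r mul0r !addr0.
  apply => //.
  - by move=> [] [].
  - by move=> _; apply: two_point_Delta; rewrite lexx ler01.
  move=> f Ff;
    rewrite big_const card_unit /= pairing_two_point subr0 mul1r mul0r !addr0.
  rewrite ler_pdivlMr//; have := Fr _ Ff.
  rewrite sumrB lerBlDl; apply: le_trans.
  rewrite (eq_bigr (fun=> f (x i))) ?sumr_const ?mulr_natr//.
  by move=> j _; rewrite (X1 (x j) (x i)).
apply: le_trans (ler_sum _ (fun i _ => gS i)) _.
by rewrite sumr_const -[_ *+ _]mulr_natr divfK// gt_eqF.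
Qed.

Lemma dirac_family_ge0 (I : finType) (g : I -> X -> R) (x : I -> X) (r : R) :
  (forall i, G (g i)) ->
  (forall f, F f -> \sum_i (f (x i) - g i (x i)) <= r) -> 0 <= r.
Proof.
have [X1|] := pselect (forall z z' : X, z = z').
  exact: dirac_family_ge0_singleton.
move=> /existsNP[a /existsNP[b /eqP ab]].
apply: (@dirac_family_ge0_perturbed (fun z => if z == a then b else a)) => z.
by have [->|] := eqVneq z a.
Qed.

(** The weight [N * c j] is rounded to an integer [k j], and [j] is repeated [k j] times. The
    rounding costs at most [B], whatever [N], so dividing by a large [N] removes it. *)
Lemma weighted_family_ge0 (J : finType) (c : J -> R) (g : J -> X -> R)
    (x : J -> X) (r : R) : (forall j, 0 <= c j) -> (forall j, G (g j)) ->
  (forall f, F f -> \sum_j c j * (f (x j) - g j (x j)) <= r) -> 0 <= r.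
Proof.
move=> c0 Gg Fr; have [ub Fub] := pointwise_ub.
set B := \sum_j `|ub (x j) - g j (x j)|.
have NrB N : 0 <= N%:R * r + B.
  (* Rounding up makes the excess weight nonnegative, so an upper bound for [f] suffices to control
     it; [F] need not be bounded below. *)
  pose k j := (Num.truncn (N%:R * c j)).+1.
  apply: (@dirac_family_ge0 {j : J & 'I_(k j)} (fun p => g (tag p))
    (fun p => x (tag p))) => // f Ff.
  pose E j := f (x j) - g j (x j).
  have -> : \sum_(p : {j & 'I_(k j)}) (f (x (tag p)) - g (tag p) (x (tag p))) =
      \sum_j (k j)%:R * E j.
    transitivity (\sum_j \sum_(i < k j) E j); first by rewrite sig_big_dep.
    by apply: eq_bigr => j _; rewrite sumr_const card_ord mulr_natl.
  apply: (@le_trans _ _ (\sum_j (N%:R * (c j * E j) + `|ub (x j) - g j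
    (x j)|))).
    apply: ler_sum => j _.
    have /truncn_itv/andP[k1 k2] : 0 <= N%:R * c j by rewrite mulr_ge0.
    have -> : (k j)%:R * E j = N%:R * (c j * E j) +
      ((k j)%:R - N%:R * c j) * E j.
      by ring.
    rewrite lerD2l; have k3 : 0 <= (k j)%:R - N%:R * c j <= 1.
      by rewrite subr_ge0 (ltW k2)/= lerBlDr /k -natr1 addrC lerD2l.
    apply: (@le_trans _ _ (((k j)%:R - N%:R * c j) * `|ub (x j) - g j (x j)|)).
      rewrite ler_wpM2l//; first by case/andP: k3.
      apply: le_trans (ler_norm _); rewrite lerD2r; exact: Fub.
    by rewrite ler_piMl//; case/andP: k3.
  by rewrite big_split/= -mulr_sumr lerD2r ler_wpM2l// Fr.
apply: (@ge0_perturb _ _ B) => e e0 _.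
have := NrB (Num.truncn e^-1).+1; set N := _.+1 => NB.
have /truncn_itv/andP[_ eN] : 0 <= e^-1 by rewrite invr_ge0 ltW.
have B0 : 0 <= B by exact: sumr_ge0.
(* [N] exceeds [e^-1], so [B] is at most [N * (e * B)]. *)
rewrite -(@pmulr_rge0 _ N%:R)// mulrDr; apply: le_trans NB _.
rewrite lerD2l mulrA ler_peMl// -ler_pdivrMr//.
by rewrite div1r ltW.
Qed.

End key_inequality.

(** * The equivalence *)

(** The cone [K] consists of the weighted combinations in the hypothesis, which is exactly the
    positivity needed for separation. A member of [G] provides the lower bound that makes each
    evaluation integrable. *)
Lemma dominating_probability (R : realType) (X : choiceType)
    (F G : set (X -> R)) (ub : X -> R) :
  G !=set0 -> (forall f x, F f -> f x <= ub x) ->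
  (forall (J : finType) (c : J -> R) (g : J -> X -> R) (x : J -> X) (r : R),
    (forall j, 0 <= c j) -> (forall j, G (g j)) ->
    (forall f, F f -> \sum_j c j * (f (x j) - g j (x j)) <= r) -> 0 <= r) ->
  exists2 m : set F -> R, fa_prob_eval m &
    forall (g : X -> R) (x : X), G g ->
      g x <= ds_integral m (fun f : F => \val f x).
Proof.
move=> [g0 Gg0] Fub FG.
pose K := [set k : F -> R | exists (J : finType) (c : J -> R)
  (g : J -> X -> R) (x : J -> X), [/\ forall j, 0 <= c j, forall j, G (g j) &
  k = fun f : F => \sum_j c j * (\val f (x j) - g j (x j))]].
have [||||m fam mK] := @cone_separation R F K.
- exists void, (of_void _), (of_void _), (of_void _).
  by split=> [[]|[]|]; apply/funext => f; rewrite big_pred0// => -[].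
- move=> _ _ [J [c [g [x [c0 Gg ->]]]]] [J' [c' [g' [x' [c'0 Gg' ->]]]]].
  exists (J + J')%type, (sum_rect _ c c'), (sum_rect _ g g'), (sum_rect _ x x').
  split; [by case|by case|].
  by apply/funext => f; rewrite big_sumType.
- move=> a _ a0 [J [c [g [x [c0 Gg ->]]]]].
  exists J, (fun j => a * c j), g, x; split=> //.
    by move=> j; rewrite mulr_ge0.
  by apply/funext => f; rewrite mulr_sumr; apply: eq_bigr => j _; rewrite mulrA.
- move=> _ r [J [c [g [x [c0 Gg ->]]]]] kr.
  apply: (FG J c g x) => // f Ff.
  exact: (kr (exist _ f (mem_set Ff))).
have above g x : G g -> ds_integrable m (fun f : F => \val f x) /\
    g x <= ds_integral m (fun f : F => \val f x).
  move=> Gg; apply: (@ds_integrable_above _ _ _ fam _ (ub x)).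
    by move=> f; apply: Fub; exact: set_valP.
  (* [u] lies above a one-term element of [K], so its integral is nonnegative. *)
  move=> s fs; pose u := s - cst_fimfun (g x).
  have -> : simple_integral m s = simple_integral m u + g x.
    have := simple_integralD fam u (cst_fimfun (g x)).
    rewrite (simple_integral_cst fam (g x)) => <-.
    congr simple_integral; apply/funext => f.
    by change (s f = s f - g x + g x); rewrite subrK.
  rewrite lerDr; apply: (mK (fun f : F => \val f x - g x) u).
    exists unit, (fun=> 1), (fun=> g), (fun=> x); split=> //.
    by apply/funext => f; rewrite big_const card_unit /= addr0 mul1r.
  by move=> f; change (\val f x - g x <= s f - g x); rewrite lerD2r.
exists m; last by move=> g x /(above g x)[].
by split=> // x; case: (above _ x Gg0).
Qed.

Lemma ds_integral_sum_le (R : realType) (T : Type) (m : set T -> R) (I : Type)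
    (r : seq I) (c : I -> R) (f : I -> T -> R) (b : R) :
  fa_probability m -> (forall i, ds_integrable m (f i)) ->
  (forall t, \sum_(i <- r) c i * f i t <= b) ->
  \sum_(i <- r) c i * ds_integral m (f i) <= b.
Proof.
move=> fam fi fb.
have /choice[s sP] i : exists s, ds_determining m (f i) s /\
    simple_integral m (s n) @[n --> \oo] --> ds_integral m (f i).
  by have [s ? ?] := ds_integralP fam (fi i); exists s.
have [det lim] := ds_determining_sum fam r c (fun i => (sP i).1) (fun i =>
  (sP i).2).
exact: (ds_determining_lim_le fam det lim fb).
Qed.

Theorem theorem3 (R : realType) (X : choiceType) (F G : set (X -> R))
    (X_nonempty : [set: X] !=set0) (F_nonempty : F !=set0)
    (F_bounded : pointwise_upper_bounded F) :
  (forall A : set ((X -> R) * (X -> R)),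
     finite_set A -> A `<=` G `*` @Delta R X ->
     ((\sum_(p \in A) pairing p.1 p.2)%:E <=
       ereal_sup [set (pairing f (fun x => \sum_(p \in A) p.2 x))%:E
                 | f in F])%E)
  <->
  exists2 m : set F -> R, fa_prob_eval m &
    forall (g : X -> R) (x : X), G g ->
      g x <= ds_integral m (fun f : F => \val f x).
Proof.
have [ub Fub] := pointwise_ub F_bounded.
split=> [FG|[m [fam mF] mG] A finA AG].
  have [f0 Ff0] := F_nonempty.
  have [G0|/set0P Gne] := eqVneq G set0; last first.
    by apply: dominating_probability Gne Fub _ => J c g x r;
      exact: weighted_family_ge0.
  (* For empty [G] any element of [fa_prob_eval] will do. Dominating [f0] yields one, since the
     combinations in question vanish at [f0]. *)
  have [||m mP _] := @dominating_probability R X F [set f0] ub _ Fub.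
  - by exists f0.
  - move=> J c g x r c0 gf0 /(_ _ Ff0); rewrite big1// => j _.
    by rewrite gf0 subrr mulr0.
  by exists m => // g x; rewrite G0.
have /finite_seqP[L0 LE] := finA; pose L := undup L0.
have {}LE : A = [set` L].
  by rewrite LE; apply/seteqP; split=> p /=; rewrite mem_undup.
have uL : uniq L by exact: undup_uniq.
have LG p : p \in L -> G p.1 /\ Delta p.2.
  by move=> pL; apply: AG; rewrite LE.
have /finite_seqP[S0 SE] : finite_set (\bigcup_(p in A) [set x | p.2 x != 0]).
  by apply: bigcup_finite => // p /AG[_ []].
pose S := undup S0; have uS : uniq S by exact: undup_uniq.
have LS p x : p \in L -> p.2 x != 0 -> x \in S.
  move=> pL px; rewrite mem_undup.
  have : (\bigcup_(p in A) [set x | p.2 x != 0]) x.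
    by exists p => //; rewrite LE.
  by rewrite SE.
pose h x := \sum_(p \in A) p.2 x.
have hE x : h x = \sum_(p <- L) p.2 x by rewrite /h LE -fsbig_seq.
have hS x : h x != 0 -> x \in S.
  apply: contraNT => xS; rewrite hE big_seq big1// => p pL; apply/eqP.
  by apply: contraNT xS; exact: LS.
(* The middle term is the [m]-average of [[f, h]], expanded over the common support [S]. *)
apply: (@le_trans _ _
  (\sum_(x <- S) h x * ds_integral m (fun f : F => \val f x))%:E).
  rewrite lee_fin LE -fsbig_seq//.
  under [leRHS]eq_bigr do rewrite hE mulr_suml.
  rewrite exchange_big/= big_seq [leRHS]big_seq; apply: ler_sum => p pL.
  rewrite (pairingE _ uS); last by move=> x; exact: LS.
  apply: ler_sum => x _; have [Gp [p0 _ _]] := LG _ pL.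
  by rewrite mulrC ler_wpM2l ?mG.
(* A member of [F] excludes the value [-oo], and [+oo] is trivial. *)
case E : (ereal_sup _) => [b| |]; last 1 first.
- have [f0 Ff0] := F_nonempty.
  have : ((pairing f0 h)%:E <= -oo)%E.
    by rewrite -E; apply: ereal_sup_ubound; exists f0.
  by rewrite leeNy_eq.
- rewrite lee_fin; apply: ds_integral_sum_le => // f.
  rewrite -lee_fin -E; apply: ereal_sup_ubound; exists (\val f).
    exact: set_valP.
  rewrite (pairingE _ uS)//; congr EFin.
  by apply: eq_bigr => x _; rewrite mulrC.
- exact: leey.
Qed.
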